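(* Let $\mathcal H$ be a regular hypergraph. Then $L_K(\mathcal H)$ has a nonzero finite-dimensional unital right module if and only if $\mathcal H$ has a full co-bisaturated sub-hypergraph $\mathcal G$ with finite vertex set admitting a nonzero monoid homomorphism $\mathcal V(L_K(\mathcal G))\to(\mathbb Z^+,+)$.
   Context: $K$ is a field; $\mathbb Z^+$ is the set of non-negative integers. A hypergraph $\mathcal H=(\mathcal H^0,\mathcal H^1,s,r)$: vertex set $\mathcal H^0$, hyperedge set $\mathcal H^1$, and for each $h$ nonempty index sets $I_h,J_h$ with families $s(h)=(s(h)_i)_{i\in I_h}$, $r(h)=(r(h)_j)_{j\in J_h}$ of vertices; regular means all $I_h,J_h$ finite. $L_K(\mathcal H)$ is the $K$-algebra generated by $\{v,h_{ij},h_{ij}^*\}$ subject to $uv=\delta_{u,v}u$; $s(h)_ih_{ij}=h_{ij}=h_{ij}r(h)_j$, $r(h)_jh_{ij}^*=h_{ij}^*=h_{ij}^*s(h)_i$; $\sum_{j\in J_h}h_{ij}h_{kj}^*=\delta_{ik}s(h)_i$; $\sum_{i\in I_h}h_{ij}^*h_{ik}=\delta_{jk}r(h)_j$. A right module $M$ is unital if $M=\sum_vMv$. Full sub-hypergraph: for $V'\subseteq\mathcal H^0$, let, for $h\in\mathcal H^1$, $I'_h=\{i\in I_h: s(h)_i\in V'\}$ and $J'_h=\{j\in J_h: r(h)_j\in V'\}$. $V'$ is co-bisaturated if for every $h$, $I'_h\ne\emptyset\iff J'_h\neq\emptyset$ (equivalently, $\mathcal H^0\setminus V'$ is bisaturated: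 for every $h$, all $s(h)_i$ lie outside $V'$ iff all $r(h)_j$ lie outside $V'$). The full co-bisaturated sub-hypergraph $\mathcal G$ on $V'$ has vertex set $V'$, hyperedges those $h$ with $I'_h\ne\emptyset$, with index sets $I'_h,J'_h$ and the restricted families. $\mathcal V(R)$ for a ring $R$: the commutative monoid of Murray–von Neumann classes $[e]$ of idempotent matrices with finitely many nonzero entries over $R$ ($e\sim f$ iff $e=xy$, $f=yx$), with $[e]+[f]=[\mathrm{diag}(e,f)]$. *)

(* Defs.v *)
From HB Require Import structures.
From mathcomp Require Import all_boot all_order all_algebra.
From Stdlib Require Import List.

Set Implicit Arguments.
Unset Strict Implicit.
Unset Printing Implicit Defensive.

Import GRing.Theory.
Local Open Scope ring_scope.

(* Hypergraphs.  Index sets I_h, J_h are finite types: this encodes   *)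
(* "regular" (all I_h, J_h finite).  Nonemptiness of I_h, J_h is the  *)
(* separate predicate [hypergraph_wf].                                 *)
Record hypergraph := Hypergraph {
  hV : Type;
  hE : Type;
  hI : hE -> finType;
  hJ : hE -> finType;
  hs : forall h : hE, hI h -> hV;
  hr : forall h : hE, hJ h -> hV
}.

Arguments hI : clear implicits.
Arguments hJ : clear implicits.
Arguments hs {_} _ _.
Arguments hr {_} _ _.

Definition hypergraph_wf (H : hypergraph) : Prop :=
  forall h : hE H, (0 < #|hI H h|)%N /\ (0 < #|hJ H h|)%N.

Section SubHypergraph.
Variables (H : hypergraph) (V' : pred (hV H)).

Definition sub_V := {v : hV H | V' v}.
Definition sub_E := {h : hE H | [exists i : hI H h, V' (hs h i)]}.
Definition sub_I (h : sub_E) : finType := {i : hI H (val h) | V' (hs (val h) i)}.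
Definition sub_J (h : sub_E) : finType := {j : hJ H (val h) | V' (hr (val h) j)}.
Definition sub_s (h : sub_E) (i : sub_I h) : sub_V :=
  exist _ (hs (val h) (val i)) (valP i).
Definition sub_r (h : sub_E) (j : sub_J h) : sub_V :=
  exist _ (hr (val h) (val j)) (valP j).

Definition subHG : hypergraph := @Hypergraph sub_V sub_E sub_I sub_J sub_s sub_r.

Definition cobisaturated : Prop :=
  forall h : hE H, (exists i : hI H h, V' (hs h i)) <-> (exists j : hJ H h, V' (hr h j)).

Definition finite_vset : Prop :=
  exists s : list (hV H), forall v, V' v -> List.In v s.
End SubHypergraph.

(* Leavitt path algebras of hypergraphs, via the universal property.  *)
(* L_K(H) is in general non-unital; we describe it as the two-sided   *)
(* ideal generated by the vertices inside its unitization, which is    *)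
(* the universal UNITAL K-algebra on the generators and relations.     *)
Section Leavitt.
Variables (K : fieldType) (H : hypergraph).

Record LK_data (A : algType K) := LKData {
  lk_v  : hV H -> A;
  lk_e  : forall h : hE H, hI H h -> hJ H h -> A;
  lk_es : forall h : hE H, hI H h -> hJ H h -> A
}.
Arguments lk_v {A} _ _.
Arguments lk_e {A} _ _ _ _.
Arguments lk_es {A} _ _ _ _.

Definition LK_rel (A : algType K) (d : LK_data A) : Prop :=
  [/\ (forall u, lk_v d u * lk_v d u = lk_v d u)
      /\ (forall u v, u <> v -> lk_v d u * lk_v d v = 0),
      (forall h i j, lk_v d (hs h i) * lk_e d h i j = lk_e d h i j
                  /\ lk_e d h i j * lk_v d (hr h j) = lk_e d h i j),
      (forall h i j, lk_v d (hr h j) * lk_es d h i j = lk_es d h i j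
                  /\ lk_es d h i j * lk_v d (hs h i) = lk_es d h i j),
      (forall h (i k : hI H h),
          \sum_(j : hJ H h) lk_e d h i j * lk_es d h k j
            = if i == k then lk_v d (hs h i) else 0)
    & (forall h (j k : hJ H h),
          \sum_(i : hI H h) lk_es d h i j * lk_e d h i k
            = if j == k then lk_v d (hr h j) else 0)].

Definition alg_hom (A C : algType K) (f : A -> C) : Prop :=
  [/\ (forall x y, f (x + y) = f x + f y),
      (forall (k : K) x, f (k *: x) = k *: f x),
      (forall x y, f (x * y) = f x * f y)
    & f 1 = 1].

Definition maps_data (A C : algType K) (d : LK_data A) (d' : LK_data C)
    (f : A -> C) : Prop :=
  [/\ (forall v, f (lk_v d v) = lk_v d' v),
      (forall h i j, f (lk_e d h i j) = lk_e d' h i j)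
    & (forall h i j, f (lk_es d h i j) = lk_es d' h i j)].

Definition is_LK_unitization (A : algType K) (d : LK_data A) : Prop :=
  LK_rel d /\
  forall (C : algType K) (d' : LK_data C), LK_rel d' ->
    (exists f : A -> C, alg_hom f /\ maps_data d d' f) /\
    (forall f g : A -> C, alg_hom f -> alg_hom g ->
        maps_data d d' f -> maps_data d d' g -> forall x, f x = g x).

Definition LK (A : algType K) (d : LK_data A) (x : A) : Prop :=
  exists n (a b : 'I_n -> A) (w : 'I_n -> hV H),
    x = \sum_(i < n) a i * lk_v d (w i) * b i.

(* L_K(H) has a nonzero finite-dimensional unital right module:
   M = K^n (row vectors), n > 0, with a K-bilinear associative right
   action m . x = m *m act x of L_K(H), and M = sum_v M v. *)
Definition has_nonzero_fd_unital_right_module (A : algType K) (d : LK_data A)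
    : Prop :=
  exists (n : nat) (act : A -> 'M[K]_n),
    (0 < n)%N /\
    (forall x y, LK d x -> LK d y -> act (x + y) = act x + act y) /\
    (forall (k : K) x, LK d x -> act (k *: x) = k *: act x) /\
    (forall x y, LK d x -> LK d y -> act (x * y) = act x *m act y) /\
    (forall m : 'rV[K]_n, exists (s : list (hV H)) (ms : hV H -> 'rV[K]_n),
        m = \sum_(v <- s) ms v *m act (lk_v d v)).
End Leavitt.

(* The monoid V(R) for R a (possibly non-unital) subring R of A, and   *)
(* monoid homomorphisms V(R) -> (Z^+, +), written out on               *)
(* representatives (idempotent square matrices over R, of any size).   *)
Section VMonoid.
Variables (A : nzRingType) (R : A -> Prop).

Definition mx_over (m n : nat) (M : 'M[A]_(m, n)) : Prop :=
  forall i j, R (M i j).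

Definition idem_over (n : nat) (e : 'M[A]_n) : Prop :=
  mx_over e /\ e *m e = e.

Definition mvn (n m : nat) (e : 'M[A]_n) (f : 'M[A]_m) : Prop :=
  exists (x : 'M[A]_(n, m)) (y : 'M[A]_(m, n)),
    [/\ mx_over x, mx_over y, e = x *m y & f = y *m x].

Definition V_hom (phi : forall n, 'M[A]_n -> nat) : Prop :=
  [/\ (forall n m (e : 'M[A]_n) (f : 'M[A]_m),
         idem_over e -> idem_over f -> mvn e f -> phi n e = phi m f),
      (forall n m (e : 'M[A]_n) (f : 'M[A]_m),
         idem_over e -> idem_over f ->
         phi (n + m)%N (block_mx e 0 0 f) = (phi n e + phi m f)%N)
    & (forall n, phi n 0 = 0%N)].

Definition V_hom_nonzero (phi : forall n, 'M[A]_n -> nat) : Prop :=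
  V_hom phi /\ exists n (e : 'M[A]_n), idem_over e /\ phi n e <> 0%N.
End VMonoid.

(* Main.v *)
Require Import Defs.
From HB Require Import structures.
From mathcomp Require Import all_boot all_order all_algebra.
From mathcomp Require Import boolp.

(** From a module [M] take for [V'] the vertices acting nontrivially; it is
    finite and co-bisaturated, L_K(G) acts on [M], and the rank of the image of
    an idempotent matrix is a nonzero homomorphism on V(L_K(G)).

    Conversely let [phi] be a nonzero homomorphism on V(L_K(G)).  The sum [p] of
    the finitely many vertices is the identity of L_K(G), so every idempotent
    [E] satisfies [E + (p - E) ~ p] and [phi] is nonzero on some vertex.  The
    relations make the matrix (h_ij) a Murray-von Neumann equivalence between
    diag (s(h)_i) and diag (r(h)_j), so the weights [phi v] satisfy
    sum_i phi (s(h)_i) = sum_j phi (r(h)_j).  Hence on the direct sum of the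
    K^(phi v) one can let every [h] act by a bijection between bases; extending
    by zero outside [V'] gives an L_K(H)-module. *)

Set Implicit Arguments.
Unset Strict Implicit.
Unset Printing Implicit Defensive.

Import GRing.Theory.
Local Open Scope ring_scope.
Local Open Scope quotient_scope.

(** * Algebra homomorphisms, quotients by joint kernels, centralizers *)

Section AlgHom.
Variables (K : fieldType) (A C : algType K) (f : A -> C).
Hypothesis hf : alg_hom f.

Lemma alg_homD x y : f (x + y) = f x + f y. Proof. by case: hf. Qed.
Lemma alg_homZ k x : f (k *: x) = k *: f x. Proof. by case: hf. Qed.
Lemma alg_homM x y : f (x * y) = f x * f y. Proof. by case: hf. Qed.
Lemma alg_hom1 : f 1 = 1. Proof. by case: hf. Qed.
Lemma alg_hom0 : f 0 = 0. Proof. by rewrite -(scale0r 0) alg_homZ scale0r. Qed.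
Lemma alg_homN x : f (- x) = - f x.
Proof. by rewrite -scaleN1r alg_homZ scaleN1r. Qed.
Lemma alg_hom_sum (I : finType) (P : pred I) (F : I -> A) :
  f (\sum_(i | P i) F i) = \sum_(i | P i) f (F i).
Proof. exact: (big_morph f alg_homD alg_hom0). Qed.
End AlgHom.

(* The quotient by the joint kernel of a class of homomorphisms inherits the
   universal property with respect to that class, without any description of
   the kernel as a generated ideal. *)
Section JointKernelQuotient.
Variables (K : fieldType) (A : algType K).
Variable F : forall C : algType K, (A -> C) -> Prop.
Hypothesis exF : exists (C : algType K) (f : A -> C), alg_hom f /\ F f.

Definition joint_eqv (x y : A) : bool :=
  `[< forall (C : algType K) (f : A -> C), alg_hom f -> F f -> f x = f y >].

Lemma joint_eqv_is_equiv : equiv_class_of joint_eqv.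
Proof.
split=> [x|x y|y x z].
- exact/asboolP.
- by apply/asboolP/asboolP => h C f hf Ff; rewrite h.
by move=> /asboolP h1 /asboolP h2; apply/asboolP => C f hf Ff; rewrite h1 ?h2.
Qed.

Canonical joint_equiv := EquivRelPack joint_eqv_is_equiv.

(** The existence proof is an index of the type because the proof of 1 <> 0 on the quotient needs a
    homomorphism of the class into a nonzero ring. *)
Definition joint_quot_of of (exists (C : algType K) (f : A -> C), alg_hom f /\ F f) :=
  {eq_quot joint_equiv}.
Local Notation Q := (joint_quot_of exF).

HB.instance Definition _ := Choice.on Q.

Definition joint_pi (x : A) : Q := \pi_{eq_quot joint_equiv} x.
Definition joint_repr (x : Q) : A := repr (x : {eq_quot joint_equiv}).

Lemma joint_reprK : cancel joint_repr joint_pi.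
Proof. exact: reprK. Qed.

(** This turns every algebra law on the quotient into the same law in the targets [C], where [f]
    passes through the operations and through the choice of representatives. *)
Lemma joint_piP x y : joint_pi x = joint_pi y <->
  forall (C : algType K) (f : A -> C), alg_hom f -> F f -> f x = f y.
Proof.
split=> [h|h].
  by apply/asboolP; apply/(@eqquotP _ _ {eq_quot joint_equiv}).
by apply/(@eqquotP _ _ {eq_quot joint_equiv})/asboolP.
Qed.

Lemma joint_piK (C : algType K) (f : A -> C) x :
  alg_hom f -> F f -> f (joint_repr (joint_pi x)) = f x.
Proof.
by move=> hf Ff; apply: (joint_piP _ x).1 hf Ff; rewrite joint_reprK.
Qed.

Let add (x y : Q) : Q := joint_pi (joint_repr x + joint_repr y).
Let opp (x : Q) : Q := joint_pi (- joint_repr x).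
Let mul (x y : Q) : Q := joint_pi (joint_repr x * joint_repr y).
Let scale (k : K) (x : Q) : Q := joint_pi (k *: joint_repr x).

Let piE (C : algType K) (f : A -> C) (hf : alg_hom f) (Ff : F f) :=
  ((fun x => joint_piK x hf Ff), alg_homD hf, alg_homM hf, alg_homN hf, alg_homZ hf,
   alg_hom0 hf, alg_hom1 hf).

Let addA : associative add.
Proof. by move=> x y z; apply/joint_piP => ? ? hf Ff; rewrite !(piE hf Ff) addrA. Qed.
Let addC : commutative add.
Proof. by move=> x y; apply/joint_piP => ? ? hf Ff; rewrite !(piE hf Ff) addrC. Qed.
Let add0 : left_id (joint_pi 0) add.
Proof.
move=> x; rewrite -[RHS]joint_reprK.
by apply/joint_piP => ? ? hf Ff; rewrite !(piE hf Ff) add0r.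
Qed.
Let addN : left_inverse (joint_pi 0) opp add.
Proof. by move=> x; apply/joint_piP => ? ? hf Ff; rewrite !(piE hf Ff) addNr. Qed.

HB.instance Definition _ := GRing.isZmodule.Build Q addA addC add0 addN.

Let mulA : associative mul.
Proof. by move=> x y z; apply/joint_piP => ? ? hf Ff; rewrite !(piE hf Ff) mulrA. Qed.
Let mul1 : left_id (joint_pi 1) mul.
Proof.
move=> x; rewrite -[RHS]joint_reprK.
by apply/joint_piP => ? ? hf Ff; rewrite !(piE hf Ff) mul1r.
Qed.
Let mulx1 : right_id (joint_pi 1) mul.
Proof.
move=> x; rewrite -[RHS]joint_reprK.
by apply/joint_piP => ? ? hf Ff; rewrite !(piE hf Ff) mulr1.
Qed.
Let mulDl : left_distributive mul +%R.
Proof. by move=> x y z; apply/joint_piP => ? ? hf Ff; rewrite !(piE hf Ff) mulrDl. Qed.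
Let mulDr : right_distributive mul +%R.
Proof. by move=> x y z; apply/joint_piP => ? ? hf Ff; rewrite !(piE hf Ff) mulrDr. Qed.
Let nz1 : joint_pi 1 != 0 :> Q.
Proof.
apply/eqP => /joint_piP h; have [C [f [hf Ff]]] := exF.
by have /eqP := h C f hf Ff; rewrite alg_hom1 // alg_hom0 // oner_eq0.
Qed.

HB.instance Definition _ := GRing.Zmodule_isNzRing.Build Q
  mulA mul1 mulx1 mulDl mulDr nz1.

Let scaleA a b (x : Q) : scale a (scale b x) = scale (a * b) x.
Proof. by apply/joint_piP => ? ? hf Ff; rewrite !(piE hf Ff) scalerA. Qed.
Let scale1 : left_id 1 scale.
Proof.
move=> x; rewrite -[RHS]joint_reprK.
by apply/joint_piP => ? ? hf Ff; rewrite !(piE hf Ff) scale1r.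
Qed.
Let scaleDr : right_distributive scale +%R.
Proof. by move=> a x y; apply/joint_piP => ? ? hf Ff; rewrite !(piE hf Ff) scalerDr. Qed.
Let scaleDl (v : Q) : {morph scale^~ v : a b / a + b}.
Proof. by move=> a b; apply/joint_piP => ? ? hf Ff; rewrite !(piE hf Ff) scalerDl. Qed.

HB.instance Definition _ := GRing.Zmodule_isLmodule.Build K Q
  scaleA scale1 scaleDr scaleDl.

Let scaleAl (a : K) (x y : Q) : a *: (x * y) = a *: x * y.
Proof. by apply/joint_piP => ? ? hf Ff; rewrite !(piE hf Ff) scalerAl. Qed.
HB.instance Definition _ := GRing.Lmodule_isLalgebra.Build K Q scaleAl.
Let scaleAr (a : K) (x y : Q) : a *: (x * y) = x * (a *: y).
Proof. by apply/joint_piP => ? ? hf Ff; rewrite !(piE hf Ff) scalerAr. Qed.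
HB.instance Definition _ := GRing.Lalgebra_isAlgebra.Build K Q scaleAr.

Definition joint_quot : algType K := Q.

Lemma joint_pi_hom : alg_hom (joint_pi : A -> joint_quot).
Proof.
split=> [x y|k x|x y|] //; apply/joint_piP => ? ? hf Ff;
  by rewrite !(piE hf Ff).
Qed.
End JointKernelQuotient.

Section Commutant.
Variables (K : fieldType) (A : algType K) (c : A).

Definition commutant : {pred A} := fun x => x * c == c * x.

Lemma commutant_subalg : subalg_closed commutant.
Proof.
split=> [|k x y|x y]; rewrite !unfold_in ?mul1r ?mulr1 //.
  by move=> /eqP hx /eqP hy; rewrite mulrDl mulrDr -scalerAl -scalerAr hx hy.
by move=> /eqP hx /eqP hy; rewrite -mulrA hy !mulrA hx.
Qed.

HB.instance Definition _ := GRing.isSubalgClosed.Build K A commutant commutant_subalg.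

Record commutant_type := Commutant { commutant_val : A; _ : commutant commutant_val }.
HB.instance Definition _ := [isSub for commutant_val].
HB.instance Definition _ := [Choice of commutant_type by <:].
HB.instance Definition _ := [SubChoice_isSubAlgebra of commutant_type by <:].

Lemma commutant_val_hom : alg_hom (commutant_val : commutant_type -> A).
Proof. by split. Qed.
End Commutant.

Lemma alg_hom_comp (K : fieldType) (A B C : algType K) (f : A -> B) (g : B -> C) :
  alg_hom f -> alg_hom g -> alg_hom (g \o f).
Proof.
move=> hf hg; split=> [x y|k x|x y|] /=.
- by rewrite (alg_homD hf) (alg_homD hg).
- by rewrite (alg_homZ hf) (alg_homZ hg).
- by rewrite (alg_homM hf) (alg_homM hg).
by rewrite (alg_hom1 hf) (alg_hom1 hg).
Qed.

Lemma joint_lift_hom (K : fieldType) (A : algType K)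
    (F : forall C : algType K, (A -> C) -> Prop)
    (exF : exists (C : algType K) (f : A -> C), alg_hom f /\ F C f)
    (C : algType K) (f : A -> C) :
  alg_hom f -> F C f ->
  alg_hom (fun x : joint_quot exF => f (joint_repr x)).
Proof.
move=> hf Ff; split=> [x y|k x|x y|].
- by rewrite joint_piK // alg_homD.
- by rewrite joint_piK // alg_homZ.
- by rewrite joint_piK // alg_homM.
by rewrite joint_piK // alg_hom1.
Qed.

Lemma sum_sub (I : finType) (P : pred I) (M : nmodType) (F : I -> M) :
  (forall i, ~~ P i -> F i = 0) -> \sum_i F i = \sum_(x : {i | P i}) F (val x).
Proof.
move=> hF; rewrite (bigID P) /= [X in _ + X]big1 ?addr0 //.
exact: (big_sub P F).
Qed.

(** * Leavitt data: transport, central elements, restriction and extension by zero *)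

Section PushForward.
Variables (K : fieldType) (H : hypergraph) (A C : algType K) (d : LK_data H A).

Definition push_data (f : A -> C) : LK_data H C :=
  LKData (fun v => f (lk_v d v)) (fun h i j => f (lk_e d i j))
         (fun h i j => f (lk_es d i j)).

Lemma push_rel (f : A -> C) : alg_hom f -> LK_rel d -> LK_rel (push_data f).
Proof.
move=> hf [[R1 R1'] R2 R3 R4 R5]; split=> /=.
- by split=> [u|u v uv]; rewrite -alg_homM // ?R1 ?R1' ?alg_hom0.
- by move=> h i j; have [e1 e2] := R2 h i j; rewrite -!alg_homM // e1 e2.
- by move=> h i j; have [e1 e2] := R3 h i j; rewrite -!alg_homM // e1 e2.
- move=> h i k; rewrite -[in RHS](alg_hom0 hf) -(fun_if f) -R4 alg_hom_sum //.
  by apply: eq_bigr => j _; rewrite alg_homM.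
move=> h j k; rewrite -[in RHS](alg_hom0 hf) -(fun_if f) -R5 alg_hom_sum //.
by apply: eq_bigr => i _; rewrite alg_homM.
Qed.

End PushForward.

Lemma push_inj_rel (K : fieldType) (H : hypergraph) (A C : algType K)
    (d : LK_data H A) (f : A -> C) :
  alg_hom f -> injective f -> LK_rel (push_data d f) -> LK_rel d.
Proof.
move=> hf fI [[R1 R1'] R2 R3 R4 R5]; split=> /=.
- split=> [u|u v uv]; apply: fI; rewrite alg_homM // ?alg_hom0 //.
    exact: R1.
  exact: R1'.
- move=> h i j; have [e1 e2] := R2 h i j.
  by split; apply: fI; rewrite alg_homM.
- move=> h i j; have [e1 e2] := R3 h i j.
  by split; apply: fI; rewrite alg_homM.
- move=> h i k; apply: fI; rewrite (fun_if f) alg_hom_sum // (alg_hom0 hf) -[RHS]R4.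
  by apply: eq_bigr => j _; rewrite alg_homM.
move=> h i k; apply: fI; rewrite (fun_if f) alg_hom_sum // (alg_hom0 hf) -[RHS]R5.
by apply: eq_bigr => j _; rewrite alg_homM.
Qed.

Section Central.
Variables (K : fieldType) (H : hypergraph) (A : algType K) (d : LK_data H A).
Hypothesis HA : is_LK_unitization d.

(* The corestriction of [id] to the commutant of [c] exists and is unique. *)
Lemma unitization_central (c : A) :
  (forall v, lk_v d v * c = c * lk_v d v) ->
  (forall h i j, lk_e (h := h) d i j * c = c * lk_e d i j) ->
  (forall h i j, lk_es (h := h) d i j * c = c * lk_es d i j) ->
  forall x, x * c = c * x.
Proof.
move=> cv ce ces x.
pose T := commutant_type c.
pose mk (y : A) (hy : y * c = c * y) : T := Commutant (introT eqP hy).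
pose dT : LK_data H T := LKData (fun v => mk _ (cv v))
  (fun h i j => mk _ (ce h i j)) (fun h i j => mk _ (ces h i j)).
have hval := commutant_val_hom c.
have relT : LK_rel dT.
  apply: (push_inj_rel hval val_inj).
  exact: HA.1.
have [[f [hf [fv fe fes]]] _] := HA.2 T dT relT.
have uniq_id := (HA.2 A d HA.1).2.
have -> : x = commutant_val (f x).
  apply: (uniq_id id (@commutant_val _ _ c \o f)) => //.
    exact: alg_hom_comp.
  by split=> [v|h i j|h i j] /=; rewrite ?fv ?fe ?fes.
by apply/eqP; case: (f x).
Qed.
End Central.

Section Restriction.
Variables (K : fieldType) (H : hypergraph) (V' : pred (hV H)) (C : algType K).
Variable d : LK_data H C.

Definition restr_data : LK_data (subHG V') C :=
  LKData (H := subHG V') (fun v : sub_V V' => lk_v d (val v))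
    (fun (h : sub_E V') (i : sub_I h) (j : sub_J h) => lk_e d (val i) (val j))
    (fun (h : sub_E V') (i : sub_I h) (j : sub_J h) => lk_es d (val i) (val j)).

Hypothesis dout : forall v, ~~ V' v -> lk_v d v = 0.

(** The restricted sums omit only terms h_ij h*_kj with r(h)_j outside [V'] and h*_ij h_ik with
    s(h)_i outside [V']. These vanish because h_ij absorbs its end vertices. *)
Lemma restr_rel : LK_rel d -> LK_rel restr_data.
Proof.
move=> [[R1 R1'] R2 R3 R4 R5]; split=> /=.
- split=> [u|u v uv]; first exact: R1.
  by apply: R1' => e; apply: uv; apply: val_inj.
- by move=> h i j; apply: R2.
- by move=> h i j; apply: R3.
- move=> h i k; rewrite -(R4 (val h) (val i) (val k)); symmetry; apply: sum_sub => j hj.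
  by rewrite -(R2 _ _ _).2 dout // mulr0 mul0r.
move=> h i k; rewrite -(R5 (val h) (val i) (val k)); symmetry; apply: sum_sub => j hj.
by rewrite -(R2 _ _ _).1 dout // mul0r mulr0.
Qed.
End Restriction.

Section Extension.
Variables (K : fieldType) (H : hypergraph) (V' : pred (hV H)) (C : algType K).
Variable d : LK_data (subHG V') C.

(** Extension by zero. The test on [h] has to return a proof, since the restricted index types
    depend on it. *)
Definition ext_fun (g : forall h : sub_E V', sub_I h -> sub_J h -> C)
    (h : hE H) (i : hI H h) (j : hJ H h) : C :=
  match pselect [exists i : hI H h, V' (hs h i)] with
  | left p =>
      let h' : sub_E V' := exist _ h p in
      match insub i : option (sub_I h'), insub j : option (sub_J h') with
      | Some i', Some j' => g h' i' j'
      | _, _ => 0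
      end
  | _ => 0
  end.

Definition ext_data : LK_data H C :=
  LKData (fun v => if (insub v : option (sub_V V')) is Some u then lk_v d u else 0)
    (ext_fun (@lk_e _ _ _ d)) (ext_fun (@lk_es _ _ _ d)).

Lemma ext_v_val (u : sub_V V') : lk_v ext_data (val u) = lk_v d u.
Proof. by rewrite /= valK. Qed.

Lemma ext_v_out v : ~~ V' v -> lk_v ext_data v = 0.
Proof. by move=> hv; rewrite /= insubN. Qed.

Lemma ext_fun_val g (h : sub_E V') (i : sub_I h) (j : sub_J h) :
  ext_fun g (val i) (val j) = g h i j.
Proof.
case: h i j => h p i j; rewrite /ext_fun /=; case: pselect => // p'.
by rewrite (bool_irrelevance p' p) !valK.
Qed.

Lemma ext_fun_outl g h (i : hI H h) (j : hJ H h) :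
  ~~ V' (hs h i) -> ext_fun g i j = 0.
Proof. by move=> hi; rewrite /ext_fun; case: pselect => // p; rewrite insubN. Qed.

Lemma ext_fun_outr g h (i : hI H h) (j : hJ H h) :
  ~~ V' (hr h j) -> ext_fun g i j = 0.
Proof.
move=> hi; rewrite /ext_fun; case: pselect => // p.
by case: insub => // i'; rewrite insubN.
Qed.

Lemma ext_rel : cobisaturated V' -> LK_rel d -> LK_rel ext_data.
Proof.
move=> cob [[R1 R1'] R2 R3 R4 R5].
have vin v (hv : V' v) : v = val (exist (fun v => V' v) v hv : sub_V V') by [].
have ein h i : V' (hs h i) -> [exists i : hI H h, V' (hs h i)].
  by move=> hi; apply/existsP; exists i.
(* Co-bisaturation: a hyperedge with a range vertex in [V'] also has a source vertex there, so it is
   not replaced by zero and the relation at r(h)_j survives. *)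
have ein' h j : V' (hr h j) -> [exists i : hI H h, V' (hs h i)].
  by move=> hj; apply/existsP/cob; exists j.
split.
- split=> [u|u v uv].
    have [hu|hu] := boolP (V' u); last by rewrite !ext_v_out ?mul0r.
    by rewrite (vin u hu) !ext_v_val R1.
  have [hu|hu] := boolP (V' u); last by rewrite ext_v_out ?mul0r.
  have [hv|hv] := boolP (V' v); last by rewrite (ext_v_out hv) mulr0.
  by rewrite (vin u hu) (vin v hv) !ext_v_val R1' // => -[].
- move=> h i j /=.
  have [hi|hi] := boolP (V' (hs h i)); last by rewrite ext_fun_outl // mulr0 mul0r.
  have [hj|hj] := boolP (V' (hr h j)); last by rewrite ext_fun_outr // mulr0 mul0r.
  pose h' : sub_E V' := exist _ h (ein _ _ hi).
  pose i' : sub_I h' := exist _ i hi; pose j' : sub_J h' := exist _ j hj.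
  have := ext_v_val (sub_s i'); have := ext_v_val (sub_r j') => /= -> ->.
  by rewrite -[i]/(val i') -[j]/(val j') (ext_fun_val _ i' j'); apply: R2.
- move=> h i j /=.
  have [hi|hi] := boolP (V' (hs h i)); last by rewrite ext_fun_outl // mulr0 mul0r.
  have [hj|hj] := boolP (V' (hr h j)); last by rewrite ext_fun_outr // mulr0 mul0r.
  pose h' : sub_E V' := exist _ h (ein _ _ hi).
  pose i' : sub_I h' := exist _ i hi; pose j' : sub_J h' := exist _ j hj.
  have := ext_v_val (sub_s i'); have := ext_v_val (sub_r j') => /= -> ->.
  by rewrite -[i]/(val i') -[j]/(val j') (ext_fun_val _ i' j'); apply: R3.
- move=> h i k.
  have [hi|hi] := boolP (V' (hs h i)); last first.
    rewrite big1 ?ext_v_out // => [|j _ /=]; first by case: eqP.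
    by rewrite ext_fun_outl ?mul0r.
  have [hk|hk] := boolP (V' (hs h k)); last first.
    rewrite big1 => [|j _ /=]; last by rewrite (ext_fun_outl _ _ hk) mulr0.
    by case: eqP => // ik; rewrite -ik hi in hk.
  pose h' : sub_E V' := exist _ h (ein _ _ hi).
  pose i' : sub_I h' := exist _ i hi; pose k' : sub_I h' := exist _ k hk.
  have := ext_v_val (sub_s i') => /= ->.
  have -> : (i == k) = (i' == k') by [].
  rewrite -R4 (@sum_sub _ (fun j => V' (hr h j))) => [|j hj]; last first.
    by rewrite ext_fun_outr ?mul0r.
  apply: eq_bigr => j _; congr (_ * _).
    exact: (ext_fun_val _ i' j).
  exact: (ext_fun_val _ k' j).
move=> h j k.
have [hj|hj] := boolP (V' (hr h j)); last first.
  rewrite big1 ?ext_v_out // => [|i _ /=]; first by case: eqP.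
  by rewrite ext_fun_outr ?mul0r.
have [hk|hk] := boolP (V' (hr h k)); last first.
  rewrite big1 => [|i _ /=]; last by rewrite (ext_fun_outr _ _ hk) mulr0.
  by case: eqP => // jk; rewrite -jk hj in hk.
pose h' : sub_E V' := exist _ h (ein' _ _ hj).
pose j' : sub_J h' := exist _ j hj; pose k' : sub_J h' := exist _ k hk.
have := ext_v_val (sub_r j') => /= ->.
have -> : (j == k) = (j' == k') by [].
rewrite -R5 (@sum_sub _ (fun i => V' (hs h i))) => [|i hi]; last first.
  by rewrite ext_fun_outl ?mul0r.
apply: eq_bigr => i _; congr (_ * _).
  exact: (@ext_fun_val _ h' i j').
exact: (@ext_fun_val _ h' i k').
Qed.
End Extension.

(** * The unitized Leavitt algebra of a full co-bisaturated sub-hypergraph *)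

Section SubUnitization.
Variables (K : fieldType) (H : hypergraph) (A : algType K) (d : LK_data H A).
Variable V' : pred (hV H).
Hypotheses (HA : is_LK_unitization d) (cob : cobisaturated V').

Definition kills_outside (C : algType K) (f : A -> C) :=
  forall v, ~~ V' v -> f (lk_v d v) = 0.

(** Sending every generator to zero satisfies the relations in K; the induced map is the
    augmentation of the unitization. *)
Lemma kills_outside_nontrivial :
  exists (C : algType K) (f : A -> C), alg_hom f /\ kills_outside f.
Proof.
pose d0 : LK_data H K^o := LKData (fun=> 0) (fun _ _ _ => 0) (fun _ _ _ => 0).
have R0 : LK_rel d0.
  split=> /=.
  - by split=> *; rewrite mul0r.
  - by move=> *; rewrite mul0r.
  - by move=> *; rewrite mul0r.
  - by move=> *; rewrite big1 ?if_same // => *; rewrite mul0r.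
  by move=> *; rewrite big1 ?if_same // => *; rewrite mul0r.
have [[f [hf [fv _ _]]] _] := HA.2 _ d0 R0.
by exists K^o, f; split=> // v _; rewrite fv.
Qed.

(** The algebra is the quotient of [A] by the joint kernel of the homomorphisms that kill all
    vertices outside [V']. Data on the sub-hypergraph extend by zero to [H], and the induced
    homomorphism on [A] descends to the quotient. *)
Lemma sub_unitization :
  exists (B : algType K) (e : LK_data (subHG V') B), is_LK_unitization e.
Proof.
pose B := joint_quot kills_outside_nontrivial.
pose p : A -> B := @joint_pi _ _ _ kills_outside_nontrivial.
have hp : alg_hom p by apply: joint_pi_hom.
have pout v : ~~ V' v -> p (lk_v d v) = 0.
  by move=> hv; apply/joint_piP => C f hf Ff; rewrite Ff // alg_hom0.
have [[_ _] R2 R3 _ _] := HA.1.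
have eout h i j : ~~ V' (hs h i) || ~~ V' (hr h j) ->
    p (lk_e d i j) = 0 /\ p (lk_es d i j) = 0.
  have [e1 e2] := R2 h i j; have [e3 e4] := R3 h i j.
  case/orP=> ho; split.
  - by rewrite -e1 alg_homM // pout // mul0r.
  - by rewrite -e4 alg_homM // pout // mulr0.
  - by rewrite -e2 alg_homM // pout // mulr0.
  by rewrite -e3 alg_homM // pout // mul0r.
exists B, (restr_data V' (push_data d p)); split.
  by apply: restr_rel => //; apply: push_rel HA.1.
move=> C d' R'.
have Rx := ext_rel cob R'.
have [[f [hf [fv fe fes]]] uni] := HA.2 C _ Rx.
split.
  have Ff : kills_outside f by move=> v hv; rewrite fv ext_v_out.
  exists (fun x : B => f (joint_repr x)); split; first exact: joint_lift_hom.
  split=> [v|h i j|h i j]; rewrite [LHS]joint_piK //.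
  - by rewrite fv ext_v_val.
  - by rewrite fe [LHS](ext_fun_val _ i j).
  by rewrite fes [LHS](ext_fun_val _ i j).
(* For uniqueness, homomorphisms on the quotient are composed with the surjection [p]. The
   composites represent the data extended by zero, so uniqueness on [A] applies. *)
have comp g : alg_hom g -> maps_data (restr_data V' (push_data d p)) d' g ->
    maps_data d (ext_data d') (g \o p).
  move=> hg [gv ge ges].
  have hin h i : V' (hs h i) -> [exists i : hI H h, V' (hs h i)].
    by move=> hi; apply/existsP; exists i.
  split=> [v|h i j|h i j].
  - have [hv|hv] := boolP (V' v); last by rewrite ext_v_out //= pout // alg_hom0.
    pose u : sub_V V' := exist _ v hv.
    exact: (etrans (gv u) (esym (@ext_v_val _ _ _ _ d' u))).
  - have [hi|hi] := boolP (V' (hs h i)); last first.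
      by rewrite /= ext_fun_outl // (eout _ _ _ _).1 ?hi ?alg_hom0.
    have [hj|hj] := boolP (V' (hr h j)); last first.
      by rewrite /= ext_fun_outr // (eout _ _ _ _).1 ?hj ?orbT ?alg_hom0.
    pose h' : sub_E V' := exist _ h (hin _ _ hi).
    pose i' : sub_I h' := exist _ i hi; pose j' : sub_J h' := exist _ j hj.
    exact: (etrans (ge h' i' j') (esym (@ext_fun_val _ _ _ _ _ h' i' j'))).
  have [hi|hi] := boolP (V' (hs h i)); last first.
    by rewrite /= ext_fun_outl // (eout _ _ _ _).2 ?hi ?alg_hom0.
  have [hj|hj] := boolP (V' (hr h j)); last first.
    by rewrite /= ext_fun_outr // (eout _ _ _ _).2 ?hj ?orbT ?alg_hom0.
  pose h' : sub_E V' := exist _ h (hin _ _ hi).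
  pose i' : sub_I h' := exist _ i hi; pose j' : sub_J h' := exist _ j hj.
  exact: (etrans (ges h' i' j') (esym (@ext_fun_val _ _ _ _ _ h' i' j'))).
move=> g1 g2 hg1 hg2 m1 m2 x; rewrite -[x]joint_reprK.
by apply: (uni (g1 \o p) (g2 \o p));
  [exact: alg_hom_comp | exact: alg_hom_comp | exact: comp | exact: comp].
Qed.
End SubUnitization.

(** * Matrix representations from balanced vertex weights *)

Section Matching.
Variables (X Y : finType) (A : {set X}) (B : {set Y}).

(** For sets of equal size this is the graph of a bijection, pairing elements by their positions in
    the two enumerations. *)
Definition matching (x : X) (y : Y) : bool :=
  [&& x \in A, y \in B & index x (enum A) == index y (enum B)].

(** The 0/1 matrix of a bijection from [A] to [B], times its transpose, is the projection onto [A].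
    The only term that can be nonzero is at the partner [y0] of [x]. *)
Lemma matching_sum (S : pzSemiRingType) x x' : #|A| = #|B| ->
  \sum_y (matching x y)%:R * (matching x' y)%:R
    = ((x \in A) && (x == x'))%:R :> S.
Proof.
move=> cAB; have [xA|xA] /= := boolP (x \in A); last first.
  by rewrite big1 // => y _; rewrite /matching (negPf xA) mul0r.
have lt_x : (index x (enum A) < #|B|)%N by rewrite -cAB cardE index_mem mem_enum.
pose y0 := enum_val (Ordinal lt_x).
have y0B : y0 \in B by apply: enum_valP.
have iy0 : index y0 (enum B) = index x (enum A).
  by rewrite /y0 (enum_val_nth y0) index_uniq ?enum_uniq -?cardE.
rewrite (bigD1 y0) //= big1 ?addr0 => [|y ne_y].
  rewrite /matching xA y0B iy0 eqxx /= mul1r; congr (_%:R); congr (nat_of_bool _).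
  apply/andP/eqP => [[x'A /eqP ix']|<-]; last by [].
  by rewrite -[x](nth_index x (s := enum A)) ?mem_enum // -ix' nth_index ?mem_enum.
rewrite /matching xA /=; case: (boolP (y \in B)) => //= yB; last by rewrite mul0r.
case: eqP => [iy|_]; last by rewrite mul0r.
case/eqP: ne_y; rewrite -[y](nth_index y0 (s := enum B)) ?mem_enum // -iy -iy0.
by rewrite nth_index ?mem_enum.
Qed.
End Matching.

Lemma matchingC (X Y : finType) (A : {set X}) (B : {set Y}) x y :
  matching A B x y = matching B A y x.
Proof. by rewrite /matching andbCA eq_sym. Qed.

Section MatchingRepresentation.
Variables (K : fieldType) (G : hypergraph) (m : nat) (k : hV G -> 'I_m).
Variables (n : nat) (vtx : 'I_n.+1 -> 'I_m).
Hypothesis kinj : injective k.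
Hypothesis balanced : forall h,
  (\sum_(i : hI G h) #|[set z | vtx z == k (hs h i)]| =
   \sum_(j : hJ G h) #|[set z | vtx z == k (hr h j)]|)%N.

Let src h := [set p : hI G h * 'I_n.+1 | vtx p.2 == k (hs h p.1)].
Let tgt h := [set p : hJ G h * 'I_n.+1 | vtx p.2 == k (hr h p.1)].

Lemma card_fibered (I : finType) (f : I -> 'I_m) :
  #|[set p : I * 'I_n.+1 | vtx p.2 == f p.1]| =
  (\sum_i #|[set z | vtx z == f i]|)%N.
Proof.
rewrite -sum1dep_card.
under [RHS]eq_bigr do rewrite -sum1dep_card.
by rewrite pair_big_dep.
Qed.

Let card_src h : #|src h| = #|tgt h|.
Proof.
have := balanced h; rewrite -(card_fibered (fun i => k (hs h i))).
by rewrite -(card_fibered (fun j => k (hr h j))).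
Qed.

(** The basis vector [z] lies over the vertex with code [vtx z], and a vertex acts as the projection
    onto the vectors over it. For fixed [h] the h_ij are the blocks of the 0/1 matrix of a bijection
    from [src h] to [tgt h], and the h*_ij those of its transpose. *)
Definition matching_data : LK_data G 'M[K]_n.+1 :=
  LKData (fun v => diag_mx (\row_z (vtx z == k v)%:R))
    (fun h i j => \matrix_(z, w) (matching (src h) (tgt h) (i, z) (j, w))%:R)
    (fun h i j => \matrix_(w, z) (matching (src h) (tgt h) (i, z) (j, w))%:R).

(** In the two summation relations, the outer sum and the sum inside the matrix product combine into
    one sum over pairs, an entry of the product of the bijection's matrix and its transpose. *)
Lemma matching_rel : LK_rel matching_data.
Proof.
have absl h (i : hI G h) j z w : (vtx z == k (hs h i))%:R *
    (matching (src h) (tgt h) (i, z) (j, w))%:R =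
    (matching (src h) (tgt h) (i, z) (j, w))%:R :> K.
  by rewrite /matching [_ \in src h]inE /=; case: eqP; rewrite ?mul1r ?mul0r.
have absr h (i : hI G h) j z w : (vtx w == k (hr h j))%:R *
    (matching (src h) (tgt h) (i, z) (j, w))%:R =
    (matching (src h) (tgt h) (i, z) (j, w))%:R :> K.
  rewrite /matching andbCA [_ \in tgt h]inE /=.
  by case: eqP; rewrite ?mul1r ?mul0r.
have dl (D : 'rV[K]_n.+1) (M : 'M_n.+1) z w : (diag_mx D * M) z w = D 0 z * M z w.
  by rewrite [_ * _]mul_diag_mx mxE.
have dr (D : 'rV[K]_n.+1) (M : 'M_n.+1) z w : (M * diag_mx D) z w = M z w * D 0 w.
  by rewrite [_ * _]mul_mx_diag mxE.
split=> /=.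
- split=> [u|u v uv]; apply/matrixP => z w; rewrite dl !mxE.
    by case: eqP => _; rewrite ?mul1r ?mul0r ?mul0rn.
  have [-> /=|] := eqVneq (vtx z) (k u); last by rewrite mul0r.
  by rewrite (introF eqP) ?mul0rn ?mulr0 // => /kinj.
- move=> h i j; split; apply/matrixP => z w.
    by rewrite dl !mxE absl.
  by rewrite dr !mxE mulrC absr.
- move=> h i j; split; apply/matrixP => w z.
    by rewrite dl !mxE absr.
  by rewrite dr !mxE mulrC absl.
- move=> h i i'; apply/matrixP => z z'; rewrite summxE.
  transitivity ((((i, z) \in src h) && ((i, z) == (i', z')))%:R : K).
    rewrite -(matching_sum K _ _ (card_src h)).
    transitivity (\sum_j \sum_w
      (matching (src h) (tgt h) (i, z) (j, w))%:R *
      (matching (src h) (tgt h) (i', z') (j, w))%:R : K).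
      by apply: eq_bigr => j _; rewrite mxE; apply: eq_bigr => w _; rewrite !mxE.
    by rewrite pair_big /=; apply: eq_bigr => -[].
  rewrite inE xpair_eqE /=; have [_|_] := eqVneq i i'; rewrite !mxE ?andbF //.
  by case: eqP => _; case: eqP.
move=> h j j'; apply/matrixP => w w'; rewrite summxE.
transitivity ((((j, w) \in tgt h) && ((j, w) == (j', w')))%:R : K).
  rewrite -(matching_sum K _ _ (esym (card_src h))).
  transitivity (\sum_i \sum_z
    (matching (tgt h) (src h) (j, w) (i, z))%:R *
    (matching (tgt h) (src h) (j', w') (i, z))%:R : K).
    apply: eq_bigr => i _; rewrite mxE; apply: eq_bigr => z _; rewrite !mxE.
    by rewrite !(matchingC (tgt h)).
  by rewrite pair_big /=; apply: eq_bigr => -[].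
rewrite inE xpair_eqE /=; have [_|_] := eqVneq j j'; rewrite !mxE ?andbF //.
by case: eqP => _; case: eqP.
Qed.

(** Every label is the code of a vertex, so each basis vector is fixed by exactly one of the
    projections. *)
Lemma matching_data_sum (t : 'I_m -> hV G) : cancel t k ->
  \sum_a lk_v matching_data (t a) = 1.
Proof.
move=> tK; apply/matrixP => z w; rewrite summxE !mxE.
under eq_bigr do rewrite !mxE tK.
rewrite sumrMnl; congr (_ *+ _).
rewrite (bigD1 (vtx z)) //= eqxx big1 ?addr0 // => a.
by rewrite eq_sym => /negPf ->.
Qed.
End MatchingRepresentation.

(** This provides a basis of the direct sum of the K^(c a): the disjoint union of the ['I_(c a)] is
    numbered, and [vtx] remembers the summand. *)
Lemma fibers_of_size m (c : 'I_m -> nat) :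
  exists n (vtx : 'I_n -> 'I_m), forall a, #|[set z | vtx z == a]| = c a.
Proof.
pose Z : finType := {a : 'I_m & 'I_(c a)}.
exists #|Z|, (fun z => tag (enum_val z)) => a.
have tag_inj : injective (enum_rank \o @Tagged _ a (fun a => 'I_(c a))).
  by move=> x y /enum_rank_inj /eqP; rewrite eq_Tagged => /eqP.
rewrite -[RHS]card_ord -(card_imset _ tag_inj).
apply: eq_card => z; rewrite inE; apply/eqP/imsetP => [<-|[x _ ->]].
  by exists (tagged (enum_val z)) => //=; rewrite -{1}[z]enum_valK; case: (enum_val z).
by rewrite /= enum_rankK.
Qed.

(** * The ideal L_K and homomorphisms on its monoid V *)

Section LKIdeal.
Variables (K : fieldType) (H : hypergraph) (A : algType K) (d : LK_data H A).

Lemma LK_gen a v b : LK d (a * lk_v d v * b).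
Proof. by exists 1%N, (fun=> a), (fun=> b), (fun=> v); rewrite big_ord1. Qed.

Lemma LKMl a x : LK d x -> LK d (a * x).
Proof.
move=> [n [l [r [w ->]]]]; exists n, (fun i => a * l i), r, w.
by rewrite mulr_sumr; apply: eq_bigr => i _; rewrite !mulrA.
Qed.

Lemma LKD x y : LK d x -> LK d y -> LK d (x + y).
Proof.
move=> [n [l [r [w ->]]]] [n' [l' [r' [w' ->]]]].
pose glue T (f : 'I_n -> T) (g : 'I_n' -> T) i :=
  match split i with inl j => f j | inr j => g j end.
exists (n + n')%N, (glue _ l l'), (glue _ r r'), (glue _ w w').
rewrite big_split_ord /=; congr (_ + _); apply: eq_bigr => i _.
  by rewrite /glue !(unsplitK (inl i)).
by rewrite /glue !(unsplitK (inr i)).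
Qed.

Lemma LK0 : LK d 0.
Proof.
(* The vertex type may be empty, so the empty family of vertices comes from the absurdity of an
   element of ['I_0]. *)
by exists 0%N, (fun=> 0), (fun=> 0), (fun i : 'I_0 => False_rect _ (notF (ltn_ord i)));
  rewrite big_ord0.
Qed.

Lemma LKN x : LK d x -> LK d (- x).
Proof. by rewrite -mulN1r; apply: LKMl. Qed.

Lemma LK_sum (I : finType) (F : I -> A) : (forall i, LK d (F i)) -> LK d (\sum_i F i).
Proof. by move=> hF; apply: big_ind => //; [exact: LK0 | exact: LKD]. Qed.

Hypothesis rel : LK_rel d.

Lemma LK_v v : LK d (lk_v d v).
Proof. by rewrite -[lk_v d v]mul1r -[_ * _]mulr1; apply: LK_gen. Qed.

Lemma LK_e h i j : LK d (lk_e (h := h) d i j).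
Proof.
have [_ R2 _ _ _] := rel.
by rewrite -(R2 h i j).1 -[lk_v d _]mul1r; apply: LK_gen.
Qed.

Lemma LK_es h i j : LK d (lk_es (h := h) d i j).
Proof.
have [_ _ R3 _ _] := rel.
by rewrite -(R3 h i j).1 -[lk_v d _]mul1r; apply: LK_gen.
Qed.
End LKIdeal.

Section VHom.
Variables (K : fieldType) (G : hypergraph) (B : algType K) (e : LK_data G B).
Variables (phi : forall n, 'M[B]_n -> nat).
Hypotheses (HB : is_LK_unitization e) (hphi : V_hom (LK e) phi).

Let rel := HB.1.

Definition V_weight v : nat := phi ((lk_v e v)%:M : 'M_1).

Lemma idem_diag n (f : 'I_n -> hV G) :
  idem_over (LK e) (diag_mx (\row_i lk_v e (f i))).
Proof.
have [[R1 _] _ _ _ _] := rel; split.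
  move=> i j; rewrite !mxE; case: eqP => _ /=; rewrite ?mulr1n ?mulr0n;
    [exact: LK_v | exact: LK0].
apply/matrixP => i j; rewrite mul_diag_mx !mxE.
by case: eqP => [->|_]; rewrite ?mulr0n ?mulr0 // !mulr1n R1.
Qed.

Lemma V_hom_diag n (f : 'I_n -> hV G) :
  phi (diag_mx (\row_i lk_v e (f i))) = (\sum_i V_weight (f i))%N.
Proof.
have [_ phiD phi0] := hphi.
elim: n f => [|n IHn] f; first by rewrite big_ord0 [diag_mx _]thinmx0.
have -> : diag_mx (\row_i lk_v e (f i)) = block_mx (lk_v e (f ord0))%:M 0 0
    (diag_mx (\row_i lk_v e (f (lift ord0 i)))) :> 'M_(1 + n).
  rewrite -[X in block_mx X]/((lk_v e (f ord0))%:M : 'M_1).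
  have -> : (lk_v e (f ord0))%:M = diag_mx (\row__ lk_v e (f ord0)) :> 'M_1.
    by apply/matrixP => i j; rewrite !ord1 !mxE.
  rewrite -diag_mx_row; congr diag_mx; apply/rowP => i; rewrite !mxE.
  case: splitP => j ij; rewrite mxE; congr (lk_v e (f _)); apply: val_inj => /=.
    by rewrite ij ord1.
  by rewrite ij.
rewrite big_ord_recl /= -IHn; apply: (phiD 1%N n); last exact: idem_diag.
have := idem_diag (fun _ : 'I_1 => f ord0).
congr idem_over.
by apply/matrixP => i j; rewrite !ord1 !mxE.
Qed.

Lemma V_weight_balanced h :
  (\sum_(i : hI G h) V_weight (hs h i) = \sum_(j : hJ G h) V_weight (hr h j))%N.
Proof.
have [_ _ _ R4 R5] := rel; have [phiE _ _] := hphi.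
rewrite (reindex _ (onW_bij _ (enum_val_bij (hI G h)))) /=.
rewrite [RHS](reindex _ (onW_bij _ (enum_val_bij (hJ G h)))) /=.
rewrite -2!V_hom_diag; apply: phiE; [exact: idem_diag | exact: idem_diag |].
(* The summation relations compute the two products of these matrices as the diagonal matrices of
   the sources and of the ranges. *)
exists (\matrix_(a, b) lk_e e (enum_val a) (enum_val b)).
exists (\matrix_(b, a) lk_es e (enum_val a) (enum_val b)).
split; try by move=> a b; rewrite mxE; first [exact: LK_e | exact: LK_es].
  apply/matrixP => a a'; rewrite !mxE.
  under eq_bigr do rewrite !mxE.
  have := R4 h (enum_val a) (enum_val a').
  rewrite (reindex _ (onW_bij _ (enum_val_bij (hJ G h)))) /= => ->.
  by rewrite (inj_eq enum_val_inj); case: eqP.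
apply/matrixP => b b'; rewrite !mxE.
under eq_bigr do rewrite !mxE.
have := R5 h (enum_val b) (enum_val b').
rewrite (reindex _ (onW_bij _ (enum_val_bij (hI G h)))) /= => ->.
by rewrite (inj_eq enum_val_inj); case: eqP.
Qed.

Variables (m : nat) (t : 'I_m -> hV G) (k : hV G -> 'I_m).
Hypotheses (tK : cancel t k) (kK : cancel k t).

Let p : B := \sum_a lk_v e (t a).

Let pv v : p * lk_v e v = lk_v e v.
Proof.
have [[R1 R1'] _ _ _ _] := rel.
rewrite /p mulr_suml (bigD1 (k v)) //= kK R1 big1 ?addr0 // => a.
by move/eqP=> ne; apply: R1' => e1; apply: ne; rewrite -e1 tK.
Qed.

Let vp v : lk_v e v * p = lk_v e v.
Proof.
have [[R1 R1'] _ _ _ _] := rel.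
rewrite /p mulr_sumr (bigD1 (k v)) //= kK R1 big1 ?addr0 // => a.
by move/eqP=> ne; apply: R1' => e1; apply: ne; rewrite e1 tK.
Qed.

(** [p] fixes each generator on both sides. Centrality in the whole unitization lets [p] pass the
    arbitrary left factor of a product a v b, which makes it an identity of the ideal. *)
Let p_central x : x * p = p * x.
Proof.
have [_ R2 R3 _ _] := rel.
apply: (unitization_central HB) => [v|h i j|h i j]; first by rewrite pv vp.
  have [e1 e2] := R2 h i j.
  by rewrite -{1}e2 -mulrA vp e2 -{2}e1 mulrA pv e1.
have [e1 e2] := R3 h i j.
by rewrite -{1}e2 -mulrA vp e2 -{2}e1 mulrA pv e1.
Qed.

Let p_id x : LK e x -> p * x = x.
Proof.
move=> [n [a [b [w ->]]]]; rewrite mulr_sumr; apply: eq_bigr => i _.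
by rewrite !mulrA -p_central -[a i * p * _]mulrA pv.
Qed.

Let LKp : LK e p. Proof. by apply: LK_sum => a; apply: LK_v. Qed.

Let pp : p * p = p. Proof. exact: p_id. Qed.

Let idem_p n : idem_over (LK e) (p%:M : 'M_n).
Proof.
split; last by rewrite -scalar_mxM pp.
by move=> i j; rewrite mxE; case: eqP => _; [exact: LKp | exact: LK0].
Qed.

(** The row and the column of all vertices multiply to [p] in one order and, by orthogonality, to
    the diagonal matrix of the vertices in the other. *)
Let phi_p n : phi (p%:M : 'M_n) = (n * \sum_a V_weight (t a))%N.
Proof.
have [phiE phiD phi0] := hphi.
elim: n => [|n IHn]; first by rewrite [_%:M]thinmx0.
rewrite mulSn -IHn -V_hom_diag.
have -> : phi (p%:M : 'M_n.+1) = phi (block_mx (p%:M : 'M_1) 0 0 (p%:M : 'M_n)).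
  by rewrite -[n.+1]/(1 + n)%N scalar_mx_block.
rewrite phiD //; congr (_ + _)%N; apply: phiE => //; first exact: idem_diag.
have [[R1 R1'] _ _ _ _] := rel.
exists (\row_a lk_v e (t a)), (\col_a lk_v e (t a)); split.
- by move=> i j; rewrite mxE; apply: LK_v.
- by move=> i j; rewrite mxE; apply: LK_v.
- apply/matrixP => i j; rewrite !ord1 !mxE; apply: eq_bigr => a _.
  by rewrite !mxE R1.
apply/matrixP => a b; rewrite !mxE big_ord1 !mxE.
case: eqP => [->|ne]; first by rewrite R1.
by rewrite R1' // => /(can_inj tK).
Qed.

(* An idempotent [E] over L_K(G) is a direct summand of a multiple of [p]:
   [E + (p - E) ~ p]. *)
Lemma V_weight_nonzero n (E : 'M[B]_n) :
  idem_over (LK e) E -> phi E <> 0%N -> exists a, V_weight (t a) <> 0%N.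
Proof.
move=> iE phiE0; apply: contrapT => all0; apply: phiE0.
have [phiE phiD _] := hphi; have [LE EE] := iE.
have pE : p%:M *m E = E.
  by apply/matrixP => i j; rewrite mul_scalar_mx mxE p_id.
have Ep : E *m p%:M = E.
  apply/matrixP => i j; rewrite mxE (bigD1 j) //= big1 => [|l /negPf lj].
    by rewrite !mxE eqxx mulr1n addr0 p_central p_id.
  by rewrite !mxE lj mulr0.
have pMp : (p%:M *m p%:M : 'M_n) = p%:M by rewrite -scalar_mxM pp.
have iE' : idem_over (LK e) (p%:M - E).
  split; last by rewrite mulmxBr !mulmxBl pE Ep EE pMp subrr subr0.
  move=> i j; rewrite !mxE; apply: LKD; last exact: LKN.
  by have [/(_ i j)] := idem_p n; rewrite mxE.
have : phi (block_mx E 0 0 (p%:M - E)) = phi (p%:M : 'M_n).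
  apply: phiE => //.
    split=> [i j|]; last first.
      by rewrite mulmx_block !(mulmx0, mul0mx, addr0, add0r) EE iE'.2.
    rewrite -[i]splitK -[j]splitK; case: (split i) (split j) => i' [] j' /=;
    rewrite ?block_mxEul ?block_mxEur ?block_mxEdl ?block_mxEdr ?mxE;
    [exact: LE | exact: LK0 | exact: LK0 | ].
    by have [/(_ i' j')] := iE'; rewrite !mxE.
  (* Since E and p - E are orthogonal idempotents with sum [p], these multiply to the block matrix
     and to [p]. *)
  exists (col_mx E (p%:M - E)), (row_mx E (p%:M - E)); split.
  - move=> i j; rewrite mxE; case: split => i'; [exact: LE | exact: iE'.1].
  - move=> i j; rewrite mxE; case: split => i'; [exact: LE | exact: iE'.1].
  - by rewrite mul_col_row iE'.2 mulmxBr mulmxBl Ep pE EE subrr.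
  by rewrite mul_row_col iE'.2 EE addrC subrK.
rewrite phiD // phi_p big1 ?muln0; first by case: (phi E).
by move=> a _; apply: contrapT => na; apply: all0; exists a.
Qed.
End VHom.

(** * Enumeration of a finite vertex set *)

Lemma In_mem (T : eqType) (x : T) (s : seq T) : List.In x s <-> x \in s.
Proof.
elim: s => //= y s IHs; rewrite inE; split=> [[->|/IHs ->]|/orP[/eqP ->|/IHs]].
- by rewrite eqxx.
- by rewrite orbT.
- by left.
by right.
Qed.

Lemma finite_vset_enum (H : hypergraph) (V' : pred (hV H)) : finite_vset V' ->
  exists m (t : 'I_m -> sub_V V') (k : sub_V V' -> 'I_m), cancel t k /\ cancel k t.
Proof.
move=> [s hs].
pose s' : seq {classic sub_V V'} := 
  undup (pmap (insub : _ -> option (sub_V V')) s : seq {classic sub_V V'}).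
have s'P (v : {classic sub_V V'}) : v \in s'.
  rewrite mem_undup; have := hs _ (valP (v : sub_V V')).
  elim: {hs s'} s => //= x s IHs [xv|/IHs vs]; last first.
    by case: (insub x) => [u|//]; rewrite inE vs orbT.
  by rewrite xv valK inE eqxx.
exists (size s'), (tnth (in_tuple s')).
exists (fun v => Ordinal (introT idP (etrans (index_mem v s') (s'P v)))).
split=> [i|v]; last first.
  by rewrite (tnth_nth v); exact: (@nth_index {classic sub_V V'} v v s' (s'P v)).
apply: val_inj; rewrite /= (tnth_nth (tnth (in_tuple s') i)).
exact: (@index_uniq {classic sub_V V'} _ i s' (ltn_ord i) (undup_uniq _)).
Qed.

(** * Ranks of matrices under a representation *)

(* [inflate] identifies M_(k,l)(M_(n+1)(K)) with matrices over [K] indexed by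
   pairs, so that it is a functor. *)
Section Inflation.
Variables (K : fieldType) (B : algType K) (n : nat) (rho : B -> 'M[K]_n.+1).
Hypothesis hrho : alg_hom rho.

Definition inflate k l (M : 'M[B]_(k, l)) :
    'M[K]_(#|{: 'I_k * 'I_n.+1}|, #|{: 'I_l * 'I_n.+1}|) :=
  \matrix_(x, y) rho (M (enum_val x).1 (enum_val y).1) (enum_val x).2 (enum_val y).2.

Lemma inflateM k l m (M : 'M[B]_(k, l)) (N : 'M[B]_(l, m)) :
  inflate (M *m N) = inflate M *m inflate N.
Proof.
apply/matrixP => x y; rewrite !mxE alg_hom_sum // summxE.
under [RHS]eq_bigr do rewrite !mxE.
rewrite -(reindex (enum_val (A := {: 'I_l * 'I_n.+1})) (P := predT)
  (F := fun p => rho (M (enum_val x).1 p.1) (enum_val x).2 p.2 *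
                 rho (N p.1 (enum_val y).1) p.2 (enum_val y).2)); last first.
  exact: onW_bij _ (enum_val_bij _).
rewrite -(pair_bigA _ (fun i z => rho (M (enum_val x).1 i) (enum_val x).2 z *
                 rho (N i (enum_val y).1) z (enum_val y).2)) /=.
by apply: eq_bigr => j _; rewrite alg_homM // mxE.
Qed.

Lemma inflateD k l (M N : 'M[B]_(k, l)) : inflate (M + N) = inflate M + inflate N.
Proof. by apply/matrixP => x y; rewrite !mxE alg_homD // mxE. Qed.

Lemma inflate0 k l : inflate (0 : 'M_(k, l)) = 0.
Proof. by apply/matrixP => x y; rewrite !mxE alg_hom0 // mxE. Qed.

Lemma inflate1 k : inflate (1%:M : 'M_k) = 1%:M.
Proof.
apply/matrixP => x y; rewrite !mxE -(inj_eq enum_val_inj).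
case: (enum_val x) (enum_val y) => a z [b w]; rewrite xpair_eqE /=.
by case: eqP => _; rewrite ?alg_hom1 ?alg_hom0 // mxE.
Qed.

(** Instead of comparing enumerations of pairs, the inflated coordinate projections [C] and
    inclusions [D] change the basis: D C = 1, and conjugation gives the block diagonal matrix, so
    each rank bounds the other. *)
Lemma rank_inflate_block k l (M : 'M[B]_k) (N : 'M[B]_l) :
  \rank (inflate (block_mx M 0 0 N)) = (\rank (inflate M) + \rank (inflate N))%N.
Proof.
pose E := block_mx M 0 0 N.
pose C := col_mx (inflate (row_mx 1%:M 0 : 'M_(k, k + l)))
                 (inflate (row_mx 0 1%:M : 'M_(l, k + l))).
pose D := row_mx (inflate (col_mx 1%:M 0 : 'M_(k + l, k)))
                 (inflate (col_mx 0 1%:M : 'M_(k + l, l))).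
have DC : D *m C = 1%:M.
  rewrite mul_row_col -!inflateM -inflateD -inflate1; congr inflate.
  rewrite !mul_col_row !(mulmx0, mul0mx, mulmx1) add_block_mx !(addr0, add0r).
  by rewrite -scalar_mx_block.
have CED : C *m inflate E *m D = block_mx (inflate M) 0 0 (inflate N).
  rewrite mul_col_mx mul_col_row -!inflateM /E !mul_row_block !mul_row_col.
  by rewrite !(mulmx0, mul0mx, mul1mx, mulmx1, addr0, add0r) !inflate0.
rewrite -rank_diag_block_mx -CED; apply/eqP; rewrite eqn_leq; apply/andP; split.
  have {1}-> : inflate E = D *m (C *m inflate E *m D) *m C.
    by rewrite !mulmxA DC mul1mx -mulmxA DC mulmx1.
  by apply: leq_trans (mxrankM_maxl _ _) _; apply: mxrankM_maxr.
by apply: leq_trans (mxrankM_maxl _ _) _; apply: mxrankM_maxr.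
Qed.

(** An idempotent x y equals x (y x) y, so its rank is at most that of y x; exchanging x and y gives
    invariance under equivalence. *)
Lemma V_hom_rank (R : B -> Prop) : V_hom R (fun k (M : 'M[B]_k) => \rank (inflate M)).
Proof.
have half k l (x : 'M[B]_(k, l)) (y : 'M[B]_(l, k)) :
    x *m y *m (x *m y) = x *m y ->
    (\rank (inflate (x *m y)) <= \rank (inflate (y *m x)))%N.
  move=> <-; rewrite -mulmxA [y *m _]mulmxA inflateM [inflate (_ *m y)]inflateM.
  by apply: leq_trans (mxrankM_maxr _ _) _; apply: mxrankM_maxl.
split=> [k l e f [_ ee] [_ ff] [x [y [_ _ exy fyx]]]|k l e f _ _|k].
- by rewrite exy fyx; apply/eqP; rewrite eqn_leq !half // -?exy -?fyx.
- exact: rank_inflate_block.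
by rewrite inflate0 mxrank0.
Qed.

Lemma rank_inflate_scalar_neq0 b : rho b != 0 -> \rank (inflate (b%:M : 'M_1)) <> 0%N.
Proof.
move=> nz /eqP; rewrite mxrank_eq0 => /eqP e0; case/eqP: nz.
apply/matrixP => z w.
have /matrixP/(_ (enum_rank (ord0, z)) (enum_rank (ord0, w))) := e0.
by rewrite !mxE !enum_rankK /= => ->.
Qed.
End Inflation.

(** * From modules to homomorphisms on V *)

Section FromModule.
Variables (K : fieldType) (H : hypergraph) (A : algType K) (d : LK_data H A).
Hypothesis HA : is_LK_unitization d.

Lemma module_to_V_hom : has_nonzero_fd_unital_right_module d ->
  exists V' : pred (hV H),
    [/\ finite_vset V', cobisaturated V' &
      forall (B : algType K) (e : LK_data (subHG V') B),
        is_LK_unitization e ->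
        exists phi : forall n, 'M[B]_n -> nat, V_hom_nonzero (LK e) phi].
Proof.
move=> [[|n] [act [// _ [actD [actZ [actM unital]]]]]].
have rel := HA.1; have [[R1 R1'] R2 R3 R4 R5] := rel.
have lv v : LK d (lk_v d v) by exact: LK_v.
have le h i j : LK d (lk_e (h := h) d i j) by exact: LK_e.
have les h i j : LK d (lk_es (h := h) d i j) by exact: LK_es.
have act0 : act 0 = 0.
  by rewrite -(scale0r 0) actZ ?scale0r //; apply: LK0.
have act_sum (I : finType) (F : I -> A) : (forall i, LK d (F i)) ->
    act (\sum_i F i) = \sum_i act (F i).
  move=> hF; elim: (index_enum I) => [|i s IHs]; first by rewrite !big_nil.
  rewrite !big_cons actD ?IHs //.
  by apply: big_ind => //; [exact: LK0 | exact: LKD].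
pose D : LK_data H 'M[K]_n.+1 := push_data d act.
(* [act] is a homomorphism only on the ideal, so each use requires membership of the elements
   involved. *)
have relD : LK_rel D.
  split=> /=.
  - by split=> [u|u v uv]; rewrite -[LHS]actM // ?R1 ?R1'.
  - move=> h i j; have [e1 e2] := R2 h i j.
    by split; rewrite -[LHS]actM // ?e1 ?e2.
  - move=> h i j; have [e1 e2] := R3 h i j.
    by split; rewrite -[LHS]actM // ?e1 ?e2.
  - move=> h i k; rewrite -[in RHS]act0 -(fun_if act) -R4 act_sum.
      by apply: eq_bigr => j _; rewrite actM.
    by move=> j; apply: LKMl.
  move=> h j k; rewrite -[in RHS]act0 -(fun_if act) -R5 act_sum.
    by apply: eq_bigr => i _; rewrite actM.
  by move=> i; apply: LKMl.
pose V' : pred (hV H) := fun v => act (lk_v d v) != 0.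
have Dout v : ~~ V' v -> lk_v D v = 0 by rewrite negbK => /eqP.
exists V'; split.
(* Each basis row is a sum over a finite list of vertices. By orthogonality, a vertex in none of
   these lists kills every basis row. *)
- have [s hs] := choice (fun i : 'I_n.+1 => unital (delta_mx 0 i)).
  exists (flatten [seq s i | i <- enum 'I_n.+1]) => v nz.
  apply/(@In_mem {classic hV H}); apply: contraT => nv; case/eqP: nz.
  apply/row_matrixP => i; rewrite row0 rowE; have [ms ->] := hs i.
  rewrite mulmx_suml; apply: (big1_seq (I := {classic hV H})) => w /= ws.
  rewrite -mulmxA -actM // R1' ?act0 ?mulmx0 //.
  move=> wv; case/negP: nv; apply/flatten_mapP; exists i; first by rewrite mem_enum.
  by rewrite -wv.
(* If all r(h)_j act as zero, so do all h_ij, and hence s(h)_i = sum_j h_ij h*_ij; the other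
   direction is symmetric. *)
- have [_ D2 D3 D4 D5] := relD => h; split=> -[i hi]; apply: contrapT => no.
    case/eqP: hi; have e := D4 h i i; rewrite eqxx in e.
    apply: (etrans (esym e)); apply: big1 => j _.
    rewrite -(D2 h i j).2 Dout ?mulr0 ?mul0r //; apply/negP => hj.
    by apply: no; exists j.
  case/eqP: hi; have e := D5 h i i; rewrite eqxx in e.
  apply: (etrans (esym e)); apply: big1 => j _.
  rewrite -(D2 h j i).1 Dout ?mul0r ?mulr0 //; apply/negP => hj.
  by apply: no; exists j.
move=> B e [rele uni].
(* The vertices outside [V'] act as zero, so the action restricts to data on the sub-hypergraph and
   induces a unital representation of [B]. *)
have [[rho [hrho [rv _ _]]] _] := uni _ _ (restr_rel Dout relD).
exists (fun k (M : 'M[B]_k) => \rank (inflate rho M)); split; first exact: V_hom_rank.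
(* If all vertices acted as zero, unitality would make the all-ones row zero. *)
have [v nz] : exists v, V' v.
  apply: contrapT => no; have [s [ms e1]] := unital (const_mx 1).
  have /rowP/(_ ord0) : const_mx 1 = 0 :> 'rV[K]_n.+1.
    rewrite e1 big1 // => v _; have -> : act (lk_v d v) = 0; last exact: mulmx0.
    by apply: Dout; apply/negP => hv; apply: no; exists v.
  by rewrite !mxE => /eqP; rewrite oner_eq0.
pose u : sub_V V' := exist _ v nz.
have [[Re _] _ _ _ _] := rele.
exists 1%N, (lk_v e u)%:M; split.
  split; last by rewrite -scalar_mxM Re.
  by move=> i j; rewrite !ord1 mxE eqxx; apply: LK_v.
by apply: rank_inflate_scalar_neq0; rewrite rv.
Qed.
End FromModule.

(** * The equivalence, with the passage from homomorphisms on V back to modules *)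

Theorem mainTheorem17 (K : fieldType) (H : hypergraph) (HwfH : hypergraph_wf H)
    (A : algType K) (d : LK_data H A) (HA : is_LK_unitization d) :
  has_nonzero_fd_unital_right_module d <->
  exists V' : pred (hV H),
    [/\ finite_vset V', cobisaturated V' &
      forall (B : algType K) (e : LK_data (subHG V') B),
        is_LK_unitization e ->
        exists phi : forall n, 'M[B]_n -> nat, V_hom_nonzero (LK e) phi].
Proof.
split; first exact: module_to_V_hom.
move=> [V' [finV cob hphi]].
have [B [e HB]] := sub_unitization HA cob.
have [phi [Hphi [l [E [iE phiE]]]]] := hphi B e HB.
have [m [t [k [tK kK]]]] := finite_vset_enum finV.
have [a0 wa0] := V_weight_nonzero HB Hphi (t := t) tK kK iE phiE.
have [n [vtx cvtx]] := fibers_of_size (fun a => V_weight e phi (t a)).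
have wvtx v : #|[set z | vtx z == k v]| = V_weight e phi v by rewrite cvtx kK.
(* The label [a0] of nonzero weight makes the basis nonempty. *)
case: n => [|n] in vtx cvtx wvtx *.
  by case: wa0; rewrite -cvtx; apply: eq_card0 => -[].
have bal h : (\sum_(i : hI (subHG V') h) #|[set z | vtx z == k (hs h i)]| =
    \sum_(j : hJ (subHG V') h) #|[set z | vtx z == k (hr h j)]|)%N.
  under eq_bigr do rewrite wvtx.
  by rewrite (V_weight_balanced HB Hphi h); apply: eq_bigr => j _; rewrite wvtx.
have relM := @matching_rel K (subHG V') m k n vtx (can_inj kK) bal.
have [[f [hf [fv _ _]]] _] := HA.2 _ _ (ext_rel cob relM).
exists n.+1, f; split=> //; split; first by move=> *; rewrite alg_homD.
split; first by move=> *; rewrite alg_homZ.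
split=> [x y _ _|M]; first by rewrite alg_homM.
(* The vertices of [V'] act as projections with sum 1, so [M] is the sum of its images under
   them. *)
exists [seq val (t a) | a <- enum 'I_m], (fun=> M).
rewrite big_map big_enum -mulmx_sumr /=.
under eq_bigr do rewrite fv ext_v_val.
by rewrite (matching_data_sum _ _ tK) mulmx1.
Qed.
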